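(* Let $(M,\phi,\xi,\eta,g)$ be a $3$-dimensional trans-Sasakian manifold of type $(\alpha,\beta)$, and let $\gamma: I\to M$ be a non-geodesic almost contact curve (parametrized by arc length). Let $\vartheta: I\to\mathbb{R}$ be the function determined by $$\nabla_{\gamma'}\gamma' = -\beta\,\xi+\vartheta\,\phi\gamma' .$$ Then the curvature $\kappa$ and the torsion $\tau$ of $\gamma$ are given by $$\kappa=\sqrt{\beta^2+\vartheta^2},\qquad \tau=\left|\alpha+\frac{\beta\vartheta'-\beta'\vartheta}{\kappa^2}\right|,$$ where $\alpha,\beta$ are evaluated along $\gamma$, $\beta'(s)=\frac{d}{ds}\beta(\gamma(s))$ and $\vartheta'(s)=\frac{d}{ds}\vartheta(s)$.
   Context: An almost contact metric structure on a $(2n+1)$-dimensional manifold $M$ is a quadruple $(\phi,\xi,\eta,g)$ of a $(1,1)$-tensor field $\phi$, a vector field $\xi$, a $1$-form $\eta$ and a Riemannian metric $g$ with $\phi^2=-I+\eta\otimes\xi$, $\eta(\xi)=1$ (hence $\phi\xi=0$, $\eta\circ\phi=0$), $g(\phi X,\phi Y)=g(X,Y)-\eta(X)\eta(Y)$ and $g(X,\xi)=\eta(X)$ for all vector fields $X,Y$. Let $\nabla$ be the Levi-Civita connection of $g$. A trans-Sasakian manifold of type $(\alpha,\beta)$ is a connected manifold $M$ with an almost contact metric structure such that $$(\nabla_X\phi)Y=\alpha\big(g(X,Y)\xi-\eta(Y)X\big)+\beta\big(g(\phi X,Y)\xi-\eta(Y)\phi X\big)$$ for all vector fields $X,Y$,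 where $\alpha,\beta$ are smooth functions on $M$; it then follows that $(\nabla_X\eta)(Y)=-\alpha g(\phi X,Y)+\beta g(\phi X,\phi Y)$. A unit speed curve $\gamma:I\to M$ in a Riemannian manifold is an $r$-Frenet curve if there are an orthonormal frame field $(E_1=\gamma',E_2,\dots,E_r)$ along $\gamma$ and positive smooth functions $k_1,\dots,k_{r-1}$ with $\nabla_{\gamma'}E_1=k_1E_2$, $\nabla_{\gamma'}E_2=-k_1E_1+k_2E_3$, ..., $\nabla_{\gamma'}E_r=-k_{r-1}E_{r-1}$. It is a geodesic if $r=1$, i.e. $\nabla_{\gamma'}\gamma'=0$. In dimension $3$ one writes $(E_1,E_2,E_3)=(T,N,B)$, $k_1=\kappa$ (curvature), $k_2=\tau$ (torsion), so that $\nabla_TT=\kappa N$, $\nabla_TN=-\kappa T+\tau B$, $\nabla_TB=-\tau N$; for $r=2$ one has $\tau=0$. Thus $\kappa=|\nabla_TT|$ and $\tau=|\nabla_TN+\kappa T|$. A Frenet curve $\gamma$ in an almost contact metric $3$-manifold is an almost contact curve if it is an integral curve of the distribution $D=\ker\eta$, i.e. $\eta(\gamma')=0$ along $\gamma$. *)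

(* Defs.v *)
From HB Require Import structures.
From mathcomp Require Import all_boot all_order all_algebra.
From mathcomp Require Import all_classical all_reals all_analysis.
Set Implicit Arguments.
Unset Strict Implicit.
Unset Printing Implicit Defensive.
Import Order.TTheory GRing.Theory Num.Theory.
Import numFieldNormedType.Exports.
Local Open Scope ring_scope.
Local Open Scope classical_set_scope.

Section Smoothness.
Context {R : realType} {V W : normedModType R}.

Fixpoint Ck (k : nat) (U : set V) (f : V -> W) : Prop :=
  if k is k'.+1 then
    (forall x, U x -> differentiable f x) /\ (forall v, Ck k' U ('D_v f))
  else forall x, U x -> {for x, continuous f}.

(* Meaningful for open U and finite-dimensional V. *)
Definition smooth_on (U : set V) (f : V -> W) : Prop := forall k, Ck k U f.

Lemma smooth_on_differentiable U f x :
  smooth_on U f -> U x -> differentiable f x.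
Proof. by move=> /(_ 1%N) [+ _] => /[apply]. Qed.
End Smoothness.

(* The values of [chart_map] off [chart_dom], and of [chart_inv] off the image
   of [chart_dom], are irrelevant. *)
Record chart (R : realType) (n : nat) (M : topologicalType) := Chart {
  chart_dom : set M;
  chart_map : M -> 'rV[R]_n;
  chart_inv : 'rV[R]_n -> M;
  chart_dom_open : open chart_dom;
  chart_img_open : open (chart_map @` chart_dom);
  chart_mapK : forall p, chart_dom p -> chart_inv (chart_map p) = p;
  chart_map_continuous :
    forall p, chart_dom p -> {for p, continuous chart_map};
  chart_inv_continuous :
    forall x, (chart_map @` chart_dom) x -> {for x, continuous chart_inv} }.

Record smoothManifold (R : realType) (n : nat) := SmoothManifold {
  carrier :> topologicalType;
  atlas : Type;
  chart_of : atlas -> chart R n carrier;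
  manifold_hausdorff : hausdorff_space carrier;
  manifold_second_countable : @second_countable carrier;
  atlas_cover : forall p : carrier, exists c, chart_dom (chart_of c) p;
  atlas_compatible : forall c d,
    smooth_on (chart_map (chart_of c) @`
                 (chart_dom (chart_of c) `&` chart_dom (chart_of d)))
              (chart_map (chart_of d) \o chart_inv (chart_of c)) }.

Section Tangent.
Context {R : realType} {n : nat} {M : smoothManifold R n}.
Implicit Types (c d e : atlas M) (p q : M).

Definition dom c : set M := chart_dom (chart_of c).
Definition coord c : M -> 'rV[R]_n := chart_map (chart_of c).
Definition param c : 'rV[R]_n -> M := chart_inv (chart_of c).
Definition transition c d : 'rV[R]_n -> 'rV[R]_n := coord d \o param c.

Definition chart_at p : atlas M := projT1 (cid (atlas_cover p)).

Lemma chart_atP p : dom (chart_at p) p.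
Proof. exact: projT2 (cid (atlas_cover p)). Qed.

Lemma transition_differentiable c d p : dom c p -> dom d p ->
  differentiable (transition c d) (coord c p).
Proof.
move=> cp dp; apply: (smooth_on_differentiable (@atlas_compatible _ _ M c d)).
by exists p.
Qed.

Lemma transition_near c d e p : dom c p -> dom d p ->
  \forall x \near coord c p,
    transition c e x = (transition d e \o transition c d) x.
Proof.
move=> cp dp.
have ic : nbhs (coord c p) (coord c @` dom c).
  by apply: open_nbhs_nbhs; split; [exact: chart_img_open|exists p].
have id : nbhs (coord c p) (param c @^-1` dom d).
  apply: (@chart_inv_continuous _ _ _ (chart_of c)); first by exists p.
  rewrite chart_mapK //; apply: open_nbhs_nbhs; split=> //.
  exact: chart_dom_open.
near=> x; rewrite /transition /=; congr (coord e _).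
rewrite [RHS]chart_mapK //.
by near: x.
Unshelve. all: by end_near. Qed.

Lemma transition_self c p : dom c p ->
  \forall x \near coord c p, transition c c x = x.
Proof.
move=> cp.
have ic : nbhs (coord c p) (coord c @` dom c).
  by apply: open_nbhs_nbhs; split; [exact: chart_img_open|exists p].
apply: filterS ic => x [q cq <-]; rewrite /transition /=.
by rewrite [param c _]chart_mapK.
Qed.

Lemma derive_transition_comp c d e p v : dom c p -> dom d p -> dom e p ->
  'D_v (transition c e) (coord c p) =
  'D_('D_v (transition c d) (coord c p)) (transition d e) (coord d p).
Proof.
move=> cp dp ep.
have tcd : transition c d (coord c p) = coord d p.
  by rewrite /transition /= [param c _]chart_mapK.
have Dcd := transition_differentiable cp dp.
have Dde : differentiable (transition d e) (transition c d (coord c p)).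
  by rewrite tcd; exact: transition_differentiable.
rewrite (near_eq_derive (g := transition d e \o transition c d)); last first.
  exact: transition_near.
rewrite deriveE; last exact: differentiable_comp.
rewrite diff_comp //= tcd !deriveE //; exact: transition_differentiable.
Qed.

Lemma derive_transition_self c p v : dom c p ->
  'D_v (transition c c) (coord c p) = v.
Proof.
move=> cp; rewrite (near_eq_derive (g := id)); first exact: derive_id.
exact: transition_self.
Qed.

(* A tangent vector at p is the family of its components in the charts around
   p, these being related by the Jacobians of the transition maps; the
   components in the other charts are set to 0 so that equality of tangent
   vectors is Leibniz equality. *)
Definition tangent_family p (v : atlas M -> 'rV[R]_n) : Prop :=
  (forall c, ~ dom c p -> v c = 0) /\
  (forall c d, dom c p -> dom d p ->
     v d = 'D_(v c) (transition c d) (coord c p)).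

Definition tangent_pred p : {pred (atlas M -> 'rV[R]_n)} :=
  fun v => `[< tangent_family p v >].

Lemma tangent_predP p v : (v \in tangent_pred p) <-> tangent_family p v.
Proof. by split=> /asboolP. Qed.

Lemma tangent_submod p : submod_closed (tangent_pred p).
Proof.
split=> [|a u v].
  apply/tangent_predP; split=> [//|c d cp dp].
  by rewrite derive0.
move=> /tangent_predP [u0 uc] /tangent_predP [v0 vc].
apply/tangent_predP; split=> [c cp|c d cp dp].
  rewrite !fctE u0 // v0 //.
  by rewrite scaler0 addr0.
have D := transition_differentiable cp dp.
rewrite !fctE.
by rewrite (uc _ _ cp dp) (vc _ _ cp dp) !deriveE // linearP.
Qed.

HB.instance Definition _ p :=
  GRing.isSubmodClosed.Build R (atlas M -> 'rV[R]_n) (tangent_pred p)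
    (tangent_submod p).

Record tangent p := Tangent {
  components :> atlas M -> 'rV[R]_n;
  componentsP : components \in tangent_pred p }.

HB.instance Definition _ p := [isSub for @components p].
HB.instance Definition _ p := [Choice of tangent p by <:].
HB.instance Definition _ p := [SubChoice_isSubLmodule of tangent p by <:].

Lemma components_compat p (u : tangent p) c d : dom c p -> dom d p ->
  u d = 'D_(u c) (transition c d) (coord c p).
Proof. by have /tangent_predP[_ +] := componentsP u => h; exact: h. Qed.

Definition tangent_of_family c p (x : 'rV[R]_n) : atlas M -> 'rV[R]_n :=
  fun d => if `[< dom c p /\ dom d p >]
           then 'D_x (transition c d) (coord c p) else 0.

Lemma tangent_ofP c p x : tangent_of_family c p x \in tangent_pred p.
Proof.
apply/tangent_predP; rewrite /tangent_of_family.
split=> [d dp|d e dp ep]; first by case: asboolP => // -[].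
case: asboolP => [[cp _]|ncp]; case: asboolP => // hd.
- exact: derive_transition_comp.
- by case: hd.
- by case: ncp; split=> //; case: hd.
- by rewrite derive0.
Qed.

(* The vector at p with components x in the chart c (0 if p is not in dom c). *)
Definition tangent_of c p x : tangent p := Tangent (tangent_ofP c p x).

Lemma tangent_ofE c p x : dom c p -> tangent_of c p x c = x.
Proof.
move=> cp; rewrite /= /tangent_of_family asboolT //.
exact: derive_transition_self.
Qed.

Lemma tangent_eqP p (u v : tangent p) c : dom c p -> u c = v c -> u = v.
Proof.
move=> cp uv; apply: val_inj; apply/funext => d /=.
have [dp|dp] := pselect (dom d p).
  by rewrite (components_compat u cp dp) (components_compat v cp dp) uv.
have /tangent_predP[u0 _] := componentsP u.
have /tangent_predP[v0 _] := componentsP v.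
by rewrite u0 // v0.
Qed.

End Tangent.

Arguments tangent {R n M}.
Arguments dom {R n M}.
Arguments coord {R n M}.
Arguments param {R n M}.
Arguments tangent_of {R n M}.

Definition vector_field {R : realType} {n : nat} (M : smoothManifold R n) :=
  forall p : M, tangent p.

Section TensorCalculus.
Context {R : realType} {n : nat} {M : smoothManifold R n}.

Definition smooth_fun (U : set M) (f : M -> R) : Prop :=
  forall c, smooth_on (coord c @` (dom c `&` U)) (f \o param c).

(* A vector field on an open set U is represented by any total field extending
   it; its values outside U are irrelevant. *)
Definition smooth_field (U : set M) (X : vector_field M) : Prop :=
  forall c, smooth_on (coord c @` (dom c `&` U))
                      (fun x => X (param c x) c).

(* u(f); for f differentiable at p the chart used is irrelevant. *)
Definition dirder p (u : tangent p) (f : M -> R) : R :=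
  'D_(u (chart_at p)) (f \o param (chart_at p)) (coord (chart_at p) p).

Record riemannian_metric := RiemannianMetric {
  metric : forall p : M, tangent p -> tangent p -> R;
  metric_linear : forall p (u : tangent p), linear (metric u : _ -> R^o);
  metric_sym : forall p (u v : tangent p), metric u v = metric v u;
  metric_pos : forall p (u : tangent p), u != 0 -> 0 < metric u u;
  metric_smooth : forall (U : set M) X Y, open U ->
    smooth_field U X -> smooth_field U Y ->
    smooth_fun U (fun p => metric (X p) (Y p)) }.

(* An affine connection acting on vector fields defined on open sets. *)
Record affine_connection := AffineConnection {
  nabla : forall p : M, tangent p -> vector_field M -> tangent p;
  nabla_linear : forall (U : set M) Y p, open U -> smooth_field U Y -> U p ->
    linear (fun u : tangent p => nabla u Y);
  nablaD : forall (U : set M) Y Z p (u : tangent p), open U ->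
    smooth_field U Y -> smooth_field U Z -> U p ->
    nabla u (fun q => Y q + Z q) = nabla u Y + nabla u Z;
  nabla_leibniz : forall (U : set M) f Y p (u : tangent p), open U ->
    smooth_fun U f -> smooth_field U Y -> U p ->
    nabla u (fun q => f q *: Y q) = dirder u f *: Y p + f p *: nabla u Y;
  nabla_smooth : forall (U : set M) X Y, open U ->
    smooth_field U X -> smooth_field U Y ->
    smooth_field U (fun p => nabla (X p) Y) }.

(* nabla_X Y - nabla_Y X = [X, Y], where [X, Y] f = X (Y f) - Y (X f). *)
Definition torsion_free (D : affine_connection) : Prop :=
  forall (U : set M) X Y f p, open U ->
    smooth_field U X -> smooth_field U Y -> smooth_fun U f -> U p ->
    dirder (nabla D (X p) Y - nabla D (Y p) X) f =
    dirder (X p) (fun q => dirder (Y q) f) -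
    dirder (Y p) (fun q => dirder (X q) f).

Definition metric_compatible (D : affine_connection) (g : riemannian_metric) :=
  forall (U : set M) Y Z p (u : tangent p), open U ->
    smooth_field U Y -> smooth_field U Z -> U p ->
    dirder u (fun q => metric g (Y q) (Z q)) =
    metric g (nabla D u Y) (Z p) + metric g (Y p) (nabla D u Z).

Definition levi_civita D g : Prop := torsion_free D /\ metric_compatible D g.

End TensorCalculus.

Arguments riemannian_metric {R n} M.
Arguments affine_connection {R n} M.

(* The identities below force n to be odd. *)
Record almost_contact_metric {R : realType} {n : nat} (M : smoothManifold R n) :=
  AlmostContactMetric {
  acm_phi : forall p : M, {linear tangent p -> tangent p};
  acm_xi : vector_field M;
  acm_eta : forall p : M, {linear tangent p -> R^o};
  acm_metric :> riemannian_metric M;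
  phi_smooth : forall (U : set M) X, open U -> smooth_field U X ->
    smooth_field U (fun p => acm_phi p (X p));
  xi_smooth : smooth_field setT acm_xi;
  eta_smooth : forall (U : set M) X, open U -> smooth_field U X ->
    smooth_fun U (fun p => acm_eta p (X p));
  phi_sq : forall p u, acm_phi p (acm_phi p u) = - u + acm_eta p u *: acm_xi p;
  eta_xi : forall p, acm_eta p (acm_xi p) = 1;
  metric_phi : forall p u v,
    metric acm_metric (acm_phi p u) (acm_phi p v) =
    metric acm_metric u v - acm_eta p u * acm_eta p v;
  metric_xi : forall p u, metric acm_metric u (acm_xi p) = acm_eta p u }.

Section TransSasakian.
Context {R : realType} {n : nat} {M : smoothManifold R n}.
Context (S : almost_contact_metric M) (D : affine_connection M).

Definition nabla_phi p (u : tangent p) (Y : vector_field M) : tangent p :=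
  nabla D u (fun q => acm_phi S q (Y q)) - acm_phi S p (nabla D u Y).

(* To be used with the Levi-Civita connection D of the metric of S. *)
Definition trans_sasakian (alpha beta : M -> R) : Prop :=
  [/\ connected [set: M], smooth_fun setT alpha, smooth_fun setT beta &
   forall (U : set M) X Y p, open U ->
     smooth_field U X -> smooth_field U Y -> U p ->
     nabla_phi (X p) Y =
       alpha p *: (metric S (X p) (Y p) *: acm_xi S p - acm_eta S p (Y p) *: X p) +
       beta p *: (metric S (acm_phi S p (X p)) (Y p) *: acm_xi S p -
                  acm_eta S p (Y p) *: acm_phi S p (X p))].

End TransSasakian.

Section Curves.
Context {R : realType} {n : nat} {M : smoothManifold R n}.
Implicit Types (I : set R) (gamma : R -> M).

(* Curves are total functions of which only the restriction to I matters. *)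
Definition smooth_curve I gamma : Prop :=
  (forall t, I t -> {for t, continuous gamma}) /\
  (forall c, smooth_on (I `&` gamma @^-1` dom c) (coord c \o gamma)).

Definition field_along gamma := forall t, tangent (gamma t).

Definition smooth_along I gamma (V : field_along gamma) : Prop :=
  forall c, smooth_on (I `&` gamma @^-1` dom c) (fun t => V t c).

(* For smooth gamma the chart used is irrelevant. *)
Definition velocity gamma : field_along gamma := fun t =>
  let c := chart_at (gamma t) in
  tangent_of c (gamma t) (derive1 (coord c \o gamma) t).

Definition coord_field (c : atlas M) (j : 'I_n) : vector_field M :=
  fun q => tangent_of c q (delta_mx 0 j).

(* The covariant derivative of V along gamma, in components:
   sum_j (V^j)' d_j + V^j nabla_{gamma'} d_j, with d_j the coordinate fields
   of a chart; for smooth gamma and V the chart used is irrelevant. *)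
Definition cov_der (D : affine_connection M) gamma (V : field_along gamma) :
    field_along gamma := fun t =>
  let c := chart_at (gamma t) in
  tangent_of c (gamma t) (derive1 (fun s => V s c) t) +
  \sum_j V t c 0 j *: nabla D (velocity gamma t) (coord_field c j).

Definition geodesic D I gamma : Prop :=
  forall t, I t -> cov_der D (velocity gamma) t = 0.

(* Indices start from 1: the frame is E 1, ..., E r and the curvature functions
   are k 1, ..., k r.-1. *)
Record frenet_curve (g : riemannian_metric M) (D : affine_connection M) I gamma
    (r : nat) (E : nat -> field_along gamma) (k : nat -> R -> R) : Prop :=
  FrenetCurve {
  frenet_rank : (0 < r)%N;
  frenet_curve_smooth : smooth_curve I gamma;
  frenet_smooth : forall i, (0 < i <= r)%N -> smooth_along I (E i);
  frenet_orthonormal : forall i j t, (0 < i <= r)%N -> (0 < j <= r)%N -> I t ->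
    metric g (E i t) (E j t) = (i == j)%:R;
  frenet_tangent : forall t, I t -> E 1%N t = velocity gamma t;
  frenet_k_smooth : forall i, (0 < i < r)%N -> smooth_on I (k i);
  frenet_k_pos : forall i t, (0 < i < r)%N -> I t -> 0 < k i t;
  frenet_eq : forall i t, (0 < i <= r)%N -> I t ->
    cov_der D (E i) t =
      (if (1 < i)%N then - k i.-1 t *: E i.-1 t else 0) +
      (if (i < r)%N then k i t *: E i.+1 t else 0) }.

Definition curvature (r : nat) (k : nat -> R -> R) (t : R) : R :=
  if (1 < r)%N then k 1%N t else 0.

Definition torsion (r : nat) (k : nat -> R -> R) (t : R) : R :=
  if (2 < r)%N then k 2%N t else 0.

Definition almost_contact_curve (S : almost_contact_metric M) I gamma : Prop :=
  forall t, I t -> acm_eta S (gamma t) (velocity gamma t) = 0.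

End Curves.

(* Main.v *)
(* With b = beta / kappa and h = theta / kappa, the principal normal is
   N = - b xi + h phi T.  The trans-Sasakian condition gives, along a curve
   tangent to ker eta,
     nabla_T (phi T) = - theta T + alpha xi,
     nabla_T xi = - alpha phi T + beta T,
   so that nabla_T N + kappa T = (h' + alpha b) phi T + (- b' + alpha h) xi.
   Since b^2 + h^2 = 1, the right-hand side is
   (alpha + b h' - b' h) (h xi + b phi T), whose second factor is a unit vector. *)
Require Import Defs.
From HB Require Import structures.
From mathcomp Require Import all_boot all_order all_algebra.
From mathcomp Require Import all_classical all_reals all_analysis.
From mathcomp Require Import ring lra.
Set Implicit Arguments.
Unset Strict Implicit.
Unset Printing Implicit Defensive.
Import Order.TTheory GRing.Theory Num.Theory.
Import numFieldNormedType.Exports.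
Local Open Scope ring_scope.
Local Open Scope classical_set_scope.

(* The imports shadow [coord] by the coordinates of mathcomp.algebra.vector. *)
Local Notation coord := Defs.coord.

(** * Calculus of the classes Ck *)

(** The obstacle is that [nabla] differentiates fields on open sets of [M], whereas T, N and phi T
    live on the curve alone and [cov_der] is a formula in one chart. The rules for sums, multiples,
    restricted fields and phi V are therefore derived from that formula, by expanding fields along
    the curve in coordinate fields, which do extend.

    The formula for nabla_T xi rests on (nabla_T phi) xi = - phi (nabla_T xi): on ker eta this can
    be solved by applying phi, and nabla_T xi lies in ker eta because xi has constant length.

    [theta] is only a function satisfying the acceleration equation; its differentiability is
    obtained from theta = kappa g(N, phi T).

    For the quotients b and h, kappa' cancels in b h' - b' h = (beta theta' - beta' theta) /
    kappa^2. Being nonnegative, the torsion is the length of nabla_T N + kappa T, whence the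
    absolute value. *)

(** The first-order expansion of [f] at [x] is also one of [g], and uniqueness of the differential
    identifies ['d g x] with ['d f x]. *)
Lemma near_eq_differentiable (R : realType) (V W : normedModType R)
    (f g : V -> W) (x : V) :
  (\near x, f x = g x) -> differentiable f x -> differentiable g x.
Proof.
move=> fg df; have fgx : f x = g x := nbhs_singleton fg.
have fg0 : \forall h \near 0, f (h + x) = g (h + x).
  by move: fg; rewrite (near_shift 0) subr0.
have ex : g \o shift x = cst (g x) + 'd f x +o_ 0 id.
  apply/eqaddoP => e e0.
  have /eqaddoP/(_ e e0) := diff_locally df.
  apply: filterS2 fg0 => h fgh.
  by rewrite !fctE /= -fgh fgx.
have dgf : 'd g x = 'd f x :> (V -> W).
  by apply: diff_unique => //; exact: diff_continuous.
by apply/diff_locallyP; rewrite dgf; split=> //; exact: diff_continuous.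
Qed.

Section Ck.
Context {R : realType}.
Implicit Types (V W : normedModType R).

Lemma Ck_sub V W k (U U' : set V) (f : V -> W) :
  U' `<=` U -> Ck k U f -> Ck k U' f.
Proof.
move=> sU; elim: k f => [|k IH] f /=; first by move=> h x /sU; exact: h.
by move=> [df h]; split=> [x /sU/df//|v]; exact/IH.
Qed.

Lemma CkW V W k (U : set V) (f : V -> W) : Ck k.+1 U f -> Ck k U f.
Proof.
elim: k f => [|k IH] f [df h]; first by move=> x /df /differentiable_continuous.
by split=> // v; apply: IH.
Qed.

Lemma open_near V (U : set V) (P : V -> Prop) x : open U -> U x ->
  (forall y, U y -> P y) -> \forall y \near x, P y.
Proof. by move=> oU Ux h; apply: filterS h _; exact: open_nbhs_nbhs. Qed.

(** On an open set, equality at the points of [U] is equality of germs, so it passes to all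
    directional derivatives. *)
Lemma eq_Ck V W k (U : set V) (f g : V -> W) : open U ->
  (forall x, U x -> f x = g x) -> Ck k U f -> Ck k U g.
Proof.
move=> oU; elim: k f g => [|k IH] f g fg.
  move=> cf x Ux; have h : f @ x --> f x := cf x Ux.
  suff : g @ x --> f x by rewrite fg.
  apply: cvg_trans h; apply: near_eq_cvg.
  exact: (open_near oU Ux).
move=> [df h]; split=> [x Ux|v].
  by apply: near_eq_differentiable (df _ Ux); exact: (open_near oU Ux).
apply: IH (h v) => x Ux; apply: near_eq_derive.
exact: (open_near oU Ux).
Qed.

Lemma Ck_cst V W k (U : set V) (a : W) : Ck k U (fun=> a).
Proof.
elim: k a => [|k IH] a /=; first by move=> x _; exact: cvg_cst.
split=> [x _|v]; first exact: differentiable_cst.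
have -> : 'D_v (fun=> a) = fun=> 0 :> W.
  by apply/funext => x; exact: derive_cst.
exact: IH.
Qed.

Lemma CkD V W k (U : set V) (f g : V -> W) : open U ->
  Ck k U f -> Ck k U g -> Ck k U (fun x => f x + g x).
Proof.
move=> oU; elim: k f g => [|k IH] f g /=.
  by move=> cf cg x Ux; apply: continuousD; [exact: cf|exact: cg].
move=> [df hf] [dg hg]; split=> [x Ux|v].
  by apply: differentiableD; [exact: df|exact: dg].
apply: (@eq_Ck _ _ _ _ (fun x => 'D_v f x + 'D_v g x)) => // [x Ux|].
  by rewrite -deriveD //; apply: diff_derivable; [exact: df|exact: dg].
exact: IH.
Qed.

Lemma Ck_sum V W k (U : set V) m (f : 'I_m -> V -> W) : open U ->
  (forall i, Ck k U (f i)) -> Ck k U (fun x => \sum_i f i x).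
Proof.
move=> oU; elim: m f => [|m IH] f hf.
  by under eq_fun do rewrite big_ord0; exact: Ck_cst.
under eq_fun do rewrite big_ord_recl; apply: CkD => //.
exact: IH.
Qed.

Lemma CkM V k (U : set V) (f g : V -> R) : open U ->
  Ck k U f -> Ck k U g -> Ck k U (fun x => f x * g x).
Proof.
move=> oU; elim: k f g => [|k IH] f g.
  by move=> cf cg x Ux; apply: continuousM; [exact: cf|exact: cg].
move=> hf hg; have [df Hf] := hf; have [dg Hg] := hg; split=> [x Ux|v].
  by apply: differentiableM; [exact: df|exact: dg].
apply: (@eq_Ck _ _ _ _
  (fun x => f x * 'D_v g x + g x * 'D_v f x)) => // [x Ux|].
  by rewrite -deriveM //; apply: diff_derivable; [exact: df|exact: dg].
(* In each Leibniz term one factor is undifferentiated; it is weakened from class k+1 to class k. *)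
by apply: CkD => //; apply: IH; [exact: CkW|exact: Hg|exact: CkW|exact: Hf].
Qed.

Lemma Ck_scalel V W k (U : set V) (f : V -> R) (w : W) : open U ->
  Ck k U f -> Ck k U (fun x => f x *: w).
Proof.
move=> oU; elim: k f => [|k IH] f /=.
  by move=> cf x Ux; apply: continuousZr_tmp; exact: cf.
move=> [df hf]; split=> [x Ux|v]; first by apply: differentiableZl; exact: df.
apply: (@eq_Ck _ _ _ _ (fun x => 'D_v f x *: w)) => // [x Ux|]; last exact: IH.
have dfx := df x Ux; have dfw := differentiableZl w dfx.
by rewrite !deriveE // diffZl.
Qed.

Lemma derive_coord V n (f : V -> 'rV[R]_n) x v j : derivable f x v ->
  'D_v (fun y => f y 0 j) x = 'D_v f x 0 j.
Proof. by move=> df; rewrite derive_mx // mxE. Qed.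

Lemma Ck_coord V k (U : set V) n (f : V -> 'rV[R]_n) j : open U ->
  Ck k U f -> Ck k U (fun x => f x 0 j).
Proof.
move=> oU; elim: k f => [|k IH] f /=.
  move=> cf x Ux; apply: (@continuous_comp _ _ _ f (fun u : 'rV[R]_n => u 0 j)).
    exact: cf.
  exact: coord_continuous.
move=> [df hf]; split=> [x Ux|v].
  apply: (@differentiable_comp _ _ _ _ f (fun u : 'rV[R]_n => u 0 j)).
    exact: df.
  exact: differentiable_coord.
apply: (@eq_Ck _ _ _ _ (fun x => 'D_v f x 0 j)) => // [x Ux|]; last exact: IH.
by rewrite derive_coord //; apply: diff_derivable; exact: df.
Qed.

(** Reduces vector-valued maps to scalar ones, for which products and compositions are treated. *)
Lemma CkP V k (U : set V) n (f : V -> 'rV[R]_n) : open U ->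
  Ck k U f <-> forall j, Ck k U (fun x => f x 0 j).
Proof.
move=> oU; split=> [h j|h]; first exact: Ck_coord.
have -> : f = fun x => \sum_j f x 0 j *: delta_mx 0 j.
  by apply/funext => x; exact: row_sum_delta.
by apply: Ck_sum => // j; apply: Ck_scalel.
Qed.

Lemma derive_row V n (f : 'rV[R]_n -> V) x v : differentiable f x ->
  'D_v f x = \sum_i v 0 i *: 'D_(delta_mx 0 i) f x.
Proof.
move=> df; rewrite deriveE // {1}(row_sum_delta v) linear_sum.
by apply: eq_bigr => i _; rewrite linearZ deriveE.
Qed.

(** The chain rule differentiates [f] in the direction ['D_v g x], which varies with [x], while [Ck]
    only speaks of fixed directions. Splitting that direction over the standard basis gives a sum of
    products to which the induction hypothesis applies. *)
Lemma Ck_comp V k (U : set V) n (U' : set 'rV[R]_n) (f : 'rV[R]_n -> R)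
    (g : V -> 'rV[R]_n) : open U -> (forall x, U x -> U' (g x)) ->
  Ck k U' f -> Ck k U g -> Ck k U (f \o g).
Proof.
move=> oU gU; elim: k f g gU => [|k IH] f g gU.
  move=> cf cg x Ux; apply: continuous_comp; first exact: cg.
  by apply: cf; exact: gU.
move=> [df hf] hg; have [dg Hg] := hg; split=> [x Ux|v].
  by apply: differentiable_comp; [exact: dg|apply: df; exact: gU].
apply: (@eq_Ck _ _ _ _
    (fun x => \sum_i 'D_v g x 0 i * 'D_(delta_mx 0 i) f (g x))) => // [x Ux|].
  rewrite [RHS]deriveE; last first.
    by apply: differentiable_comp; [exact: dg|apply: df; exact: gU].
  rewrite diff_comp /=; [|exact: dg|apply: df; exact: gU].
  rewrite -(deriveE v); last exact: dg.
  rewrite -deriveE; last by apply: df; exact: gU.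
  by rewrite derive_row //; apply: df; exact: gU.
apply: Ck_sum => // i; apply: CkM => //.
  by apply: Ck_coord => //; exact: Hg.
by apply: (IH ('D_(delta_mx 0 i) f) g gU); [exact: hf|exact: CkW].
Qed.

End Ck.

(** * Smooth fields and locality of connections *)

Section Geometry.
Context {R : realType} {n : nat} {M : smoothManifold R n}.
Implicit Types (c d : atlas M) (p q : M) (U : set M).

Lemma componentsD p (u v : tangent p) c : (u + v) c = u c + v c.
Proof. by []. Qed.

Lemma componentsZ p a (u : tangent p) c : (a *: u) c = a *: u c.
Proof. by []. Qed.

Lemma components_sum p m (u : 'I_m -> tangent p) c :
  (\sum_i u i) c = \sum_i u i c.
Proof.
by apply: (big_morph (fun w : tangent p => w c)) => // v w; exact: componentsD.
Qed.

Lemma dom_near c p : dom c p -> nbhs p (dom c).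
Proof.
by move=> cp; apply: open_nbhs_nbhs; split=> //; exact: chart_dom_open.
Qed.

Lemma param_continuous c p : dom c p -> param c x @[x --> coord c p] --> p.
Proof.
move=> cp; have := @chart_inv_continuous _ _ _ (chart_of c) (coord c p).
rewrite /prop_for /continuous_at chart_mapK //; apply.
by exists p.
Qed.

(** Smoothness of functions and fields on [U] is tested on these images, and the calculus of [Ck]
    needs them open. Continuity of [param c] keeps nearby points in [U]. *)
Lemma open_coord c U : open U -> open (coord c @` (dom c `&` U)).
Proof.
move=> oU; rewrite openE => _ [p [cp Up] <-].
have h : \forall x \near coord c p, (coord c @` dom c) x /\ U (param c x).
  near=> x; split; near: x.
    apply: open_nbhs_nbhs; split; last by exists p.
    exact: chart_img_open.
  by apply: (param_continuous cp); exact: open_nbhs_nbhs.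
apply: filterS h => _ [[q cq <-] Uq]; exists q => //; split=> //.
by move: Uq; rewrite /param chart_mapK.
Unshelve. all: by end_near. Qed.

Lemma open_dom c : open (dom c).
Proof. exact: chart_dom_open. Qed.

Lemma paramK c p : dom c p -> param c (coord c p) = p.
Proof. exact: chart_mapK. Qed.

Lemma transitionE c d p : dom c p -> transition c d (coord c p) = coord d p.
Proof. by move=> cp; rewrite /transition /= paramK. Qed.

Lemma smooth_fieldS U U' (X : vector_field M) :
  U' `<=` U -> smooth_field U X -> smooth_field U' X.
Proof.
move=> sU hf c k; apply: Ck_sub (hf c k).
by move=> _ [q [cq /sU Uq] <-]; exists q.
Qed.

Lemma eq_smooth_field U (X Y : vector_field M) : open U ->
  (forall q, U q -> X q = Y q) -> smooth_field U X -> smooth_field U Y.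
Proof.
move=> oU XY hX c k; apply: eq_Ck (hX c k); first exact: open_coord.
by move=> _ [q [cq Uq] <-]; rewrite paramK // XY.
Qed.

Lemma smooth_fieldZ U f (X : vector_field M) : open U ->
  smooth_fun U f -> smooth_field U X -> smooth_field U (fun q => f q *: X q).
Proof.
move=> oU hf hX c k.
have oc : open (coord c @` (dom c `&` U)) by exact: open_coord.
apply/CkP => // j.
have -> : (fun x => (f (param c x) *: X (param c x)) c 0 j) =
    (fun x => (f \o param c) x * X (param c x) c 0 j).
  by apply/funext => x; rewrite componentsZ mxE.
apply: CkM => //; first exact: hf.
by apply: (Ck_coord j oc); exact: hX.
Qed.

Lemma smooth_field0 U : smooth_field U (fun q : M => 0 : tangent q).
Proof. by move=> c k; exact: Ck_cst. Qed.

Lemma smooth_field_sum U m (X : 'I_m -> vector_field M) : open U ->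
  (forall i, smooth_field U (X i)) -> smooth_field U (fun q => \sum_i X i q).
Proof.
move=> oU hX c k.
have oc : open (coord c @` (dom c `&` U)) by exact: open_coord.
have -> : (fun x => (\sum_i X i (param c x)) c) =
    (fun x => \sum_i X i (param c x) c).
  by apply/funext => x; exact: components_sum.
by apply: Ck_sum => // i; exact: hX.
Qed.

Lemma smooth_fun_cst U (a : R) : smooth_fun U (fun=> a).
Proof. by move=> c k; exact: Ck_cst. Qed.

Lemma coord_fieldE c d q j : dom c q -> dom d q ->
  coord_field c j q d = 'D_(delta_mx 0 j) (transition c d) (coord c q).
Proof. by move=> cq dq; rewrite /= /tangent_of_family asboolT. Qed.

(** In a chart [d] the components are a column of the Jacobian of [transition c d], evaluated at the
    point [transition d c x]. One derivative is lost, so class k uses compatibility of the charts at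
    class k+1. *)
Lemma smooth_coord_field c j : smooth_field (dom c) (coord_field c j).
Proof.
move=> d k; have od : open (coord d @` (dom d `&` dom c)).
  by apply: open_coord; exact: open_dom.
apply/CkP => // l.
pose g y := 'D_(delta_mx 0 j) (transition c d) y 0 l.
apply: (@eq_Ck _ _ _ _ _ (g \o transition d c)) => //.
  move=> _ [q [dq cq] <-].
  by rewrite /comp /g transitionE // paramK // coord_fieldE.
apply: (@Ck_comp _ _ _ _ _ (coord c @` (dom c `&` dom d))) => //.
- by move=> _ [q [dq cq] <-]; rewrite transitionE //; exists q.
- apply: Ck_coord; first exact: open_coord (@open_dom d).
  exact: (@atlas_compatible _ _ M c d k.+1).2.
- exact: (@atlas_compatible _ _ M d c k).
Qed.

(** Smoothness of [X] controls its components in [d] read in the same chart [d]. Here the components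
    in a fixed [c] are read in any [d], so the Jacobian of the transition enters. *)
Lemma smooth_component U c (X : vector_field M) j : open U -> U `<=` dom c ->
  smooth_field U X -> smooth_fun U (fun q => X q c 0 j).
Proof.
move=> oU sU hX d k.
have od : open (coord d @` (dom d `&` U)) by exact: open_coord.
have comp k' : Ck k' (coord d @` (dom d `&` U)) (transition d c).
  apply: Ck_sub (@atlas_compatible _ _ M d c k').
  by move=> _ [q [dq /sU cq] <-]; exists q.
pose g x i := X (param d x) d 0 i * 'D_(delta_mx 0 i) (transition d c) x 0 j.
apply: (@eq_Ck _ _ _ _ _ (fun x => \sum_i g x i)) => //.
  move=> _ [q [dq Uq] <-]; rewrite /g /= paramK //.
  rewrite (components_compat (X q) dq (sU _ Uq)).
  rewrite derive_row; last exact: (transition_differentiable dq (sU _ Uq)).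
  by rewrite summxE; apply: eq_bigr => i _; rewrite mxE.
apply: Ck_sum => // i; apply: CkM => //.
  by apply: (Ck_coord i od); exact: hX.
by apply: Ck_coord => //; exact: (comp k.+1).2.
Qed.

Lemma tangent_sum_coord c p (u : tangent p) : dom c p ->
  u = \sum_j u c 0 j *: coord_field c j p.
Proof.
move=> cp; apply: (tangent_eqP cp); rewrite components_sum [LHS]row_sum_delta.
by apply: eq_bigr => j _; rewrite componentsZ /coord_field tangent_ofE.
Qed.

Lemma eq_dirder p (u : tangent p) (f g : M -> R) :
  (\forall q \near p, f q = g q) -> dirder u f = dirder u g.
Proof.
move=> fg; apply: near_eq_derive.
exact: (param_continuous (chart_atP p) fg).
Qed.

Lemma dirder_cst p (u : tangent p) (a : R) : dirder u (fun=> a) = 0.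
Proof. exact: derive_cst. Qed.

Section Connection.
Variable D : affine_connection M.

(* Locality comes from the Leibniz rule for the indicator function of U, which
   is smooth on U. *)
Lemma nabla_local U (X Y : vector_field M) p (u : tangent p) : open U -> U p ->
  smooth_field U X -> (forall q, U q -> X q = Y q) -> nabla D u X = nabla D u Y.
Proof.
move=> oU Up hX XY.
have hY : smooth_field U Y by exact: eq_smooth_field hX.
pose f q : R := if `[< U q >] then 1 else 0.
have fU q : U q -> f q = 1 by move=> Uq; rewrite /f asboolT.
have hf : smooth_fun U f.
  move=> c k; apply: (@eq_Ck _ _ _ _ _ (fun=> 1 : R)); first exact: open_coord.
    by move=> _ [q [cq Uq] <-]; rewrite /= paramK // fU.
  exact: Ck_cst.
have df : dirder u f = 0.
  rewrite -(dirder_cst u 1); apply: eq_dirder.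
  by apply: filterS (open_nbhs_nbhs (conj oU Up)) => q /fU.
have fXY : (fun q => f q *: X q) = (fun q => f q *: Y q).
  apply: functional_extensionality_dep => q; rewrite /f.
  by case: asboolP => [/XY ->|]; rewrite // !scale0r.
have := nabla_leibniz D u oU hf hX Up; rewrite fXY.
by rewrite (nabla_leibniz D u oU hf hY Up) df fU // !scale0r !add0r !scale1r.
Qed.

Lemma nabla0 p (u : tangent p) : nabla D u (fun q => 0 : tangent q) = 0.
Proof.
have := nabla_leibniz D u openT (smooth_fun_cst setT 0)
  (@smooth_field0 setT) (I : setT p).
rewrite dirder_cst !scale0r addr0 => <-; congr nabla.
by apply: functional_extensionality_dep => q; rewrite scale0r.
Qed.

Lemma nabla_sum U p (u : tangent p) m (X : 'I_m -> vector_field M) :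
  open U -> U p -> (forall i, smooth_field U (X i)) ->
  nabla D u (fun q => \sum_i X i q) = \sum_i nabla D u (X i).
Proof.
move=> oU Up; elim: m X => [|m IH] X hX.
  rewrite big_ord0 -(nabla0 u); congr nabla.
  by apply: functional_extensionality_dep => q; rewrite big_ord0.
rewrite big_ord_recl -IH // -(nablaD D u oU) //; last exact: smooth_field_sum.
congr nabla.
by apply: functional_extensionality_dep => q; rewrite big_ord_recl.
Qed.

(** The expansion of [X] in coordinate fields is valid on [dom c] only, so locality is needed before
    the Leibniz rule. The result has the shape of [cov_der]. *)
Lemma nabla_coord U c (X : vector_field M) p (u : tangent p) :
  open U -> U p -> dom c p -> smooth_field U X ->
  nabla D u X = \sum_j (dirder u (fun q => X q c 0 j) *: coord_field c j p +
                        X p c 0 j *: nabla D u (coord_field c j)).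
Proof.
move=> oU Up cp hX.
have oUc : open (U `&` dom c) by apply: openI => //; exact: open_dom.
have hXc : smooth_field (U `&` dom c) X by apply: smooth_fieldS hX => q [].
have hf j : smooth_fun (U `&` dom c) (fun q => X q c 0 j).
  by apply: smooth_component => // q [].
have hd j : smooth_field (U `&` dom c) (coord_field c j).
  by apply: smooth_fieldS (smooth_coord_field c j) => q [].
rewrite (@nabla_local (U `&` dom c) X
  (fun q => \sum_j X q c 0 j *: coord_field c j q)) //; last first.
  by move=> q [_ cq]; exact: tangent_sum_coord.
rewrite (@nabla_sum (U `&` dom c)) //; last by move=> j; exact: smooth_fieldZ.
by apply: eq_bigr => j _; rewrite (nabla_leibniz D u oUc (hf j) (hd j)).
Qed.

End Connection.
End Geometry.

(** * Covariant derivatives along a curve *)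

Section AlongCurve.
Context {R : realType} {n : nat} {M : smoothManifold R n}.
Context (D : affine_connection M) (gamma : R -> M) (t : R).
Implicit Types (V W : field_along gamma) (f : M -> R) (X : vector_field M).

Let p := gamma t.
Let c := chart_at p.
Let T : tangent p := velocity gamma t.

(** Couples the value with differentiability of the components, in the manner of [is_derive], since
    [cov_der] alone is total and would give no information about differentiability. *)
Definition is_cov_der V (w : tangent (gamma t)) : Prop :=
  derivable (fun s => V s (chart_at (gamma t))) t 1 /\ cov_der D V t = w.

Lemma is_cov_der_derivable V :
  derivable (fun s => V s (chart_at (gamma t))) t 1 ->
  is_cov_der V (cov_der D V t).
Proof. by []. Qed.

Lemma tangent_ofD x y :
  tangent_of c p (x + y) = tangent_of c p x + tangent_of c p y.
Proof.
have cp : dom c p by exact: chart_atP.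
by apply: (tangent_eqP cp); rewrite componentsD !tangent_ofE.
Qed.

Lemma tangent_ofZ a x : tangent_of c p (a *: x) = a *: tangent_of c p x.
Proof.
have cp : dom c p by exact: chart_atP.
by apply: (tangent_eqP cp); rewrite componentsZ !tangent_ofE.
Qed.

Lemma tangent_ofK (u : tangent p) : tangent_of c p (u c) = u.
Proof.
have cp : dom c p by exact: chart_atP.
by apply: (tangent_eqP cp); rewrite tangent_ofE.
Qed.

Lemma near_cov_der V W : (\forall s \near t, V s = W s) ->
  cov_der D V t = cov_der D W t.
Proof.
move=> VW; rewrite /cov_der (nbhs_singleton VW) !derive1E.
rewrite (@near_eq_derive _ _ _ _ (fun s => W s (chart_at (gamma t)))) //.
by apply: filterS VW => s ->.
Qed.

Lemma near_is_cov_der V W w : (\forall s \near t, V s = W s) ->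
  is_cov_der V w -> is_cov_der W w.
Proof.
move=> VW [dV <-]; split; last exact/esym/near_cov_der.
apply: near_eq_derivable dV.
by apply: filterS VW => s ->.
Qed.

Lemma is_cov_derD V W v w : is_cov_der V v -> is_cov_der W w ->
  is_cov_der (fun s => V s + W s) (v + w).
Proof.
move=> [dV <-] [dW <-].
have VWE : (fun s => (V s + W s) (chart_at (gamma t))) =
    (fun s => V s (chart_at (gamma t))) + (fun s => W s (chart_at (gamma t))).
  by apply/funext => s; exact: componentsD.
split; first by rewrite VWE; exact: (derivableD dV dW).
rewrite /cov_der !derive1E VWE (deriveD dV dW) tangent_ofD addrACA.
rewrite -big_split /=; congr (_ + _ + _).
apply: eq_bigr => j _; rewrite -scalerDl; congr (_ *: _).
by rewrite -[LHS]/((V t c + W t c) 0 j) mxE.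
Qed.

Lemma is_cov_derZ (a : R -> R) da V v : is_derive t 1 a da -> is_cov_der V v ->
  is_cov_der (fun s => a s *: V s) (da *: V t + a t *: v).
Proof.
move=> ha [dV <-].
have dVj i j : derivable (fun s => V s c i j) t 1.
  exact: ((derivable_mxP _ _ _).1 dV i j).
have dij i j : is_derive t 1 (fun s => (a s *: V s) c i j)
    (a t * 'D_1 (fun s => V s c i j) t + V t c i j * da).
  have -> : (fun s => (a s *: V s) c i j) = a * (fun s => V s c i j).
    by apply/funext => s; rewrite componentsZ mxE.
  have hV := derivableP (dVj i j).
  by apply: is_derive_eq.
have daV : derivable (fun s => (a s *: V s) c) t 1.
  by apply/derivable_mxP => i j; exact: (@ex_derive _ _ _ _ _ _ _ (dij i j)).
split=> //; rewrite /cov_der !derive1E.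
have -> : 'D_1 (fun s => (a s *: V s) (chart_at (gamma t))) t =
   a t *: 'D_1 (fun s => V s c) t + da *: V t c.
  apply/matrixP => i j; rewrite (derive_mx daV) !mxE (derive_mx dV) mxE.
  by rewrite (@derive_val _ _ _ _ _ _ _ (dij i j)) (mulrC da).
rewrite tangent_ofD !tangent_ofZ tangent_ofK scalerDr scaler_sumr.
rewrite (addrC (a t *: _)) addrA; congr (_ + _ + _).
apply: eq_bigr => j _; rewrite scalerA; congr (_ *: _).
by rewrite -[LHS]/((a t *: V t c) 0 j) mxE.
Qed.

Lemma is_cov_der0 : is_cov_der (fun s => 0) 0.
Proof.
split; first exact: derivable_cst.
rewrite /cov_der big1 => [|j _]; last by rewrite [X in X *: _]mxE scale0r.
rewrite derive1_cst addr0 -[RHS](tangent_ofK 0).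
by [].
Qed.

Lemma is_cov_der_sum m (V : 'I_m -> field_along gamma) w :
  (forall i, is_cov_der (V i) (w i)) ->
  is_cov_der (fun s => \sum_i V i s) (\sum_i w i).
Proof.
elim: m V w => [|m IH] V w h.
  rewrite big_ord0; apply: near_is_cov_der is_cov_der0.
  by apply: (@nearW _ (nbhs t)) => s; rewrite big_ord0.
rewrite big_ord_recl.
have hS := IH _ _ (fun i => h (lift ord0 i)).
apply: near_is_cov_der (is_cov_derD (h ord0) hS).
by apply: (@nearW _ (nbhs t)) => s; rewrite big_ord_recl.
Qed.

Context (cg : gamma s @[s --> t] --> gamma t).
Context (dg : derivable (coord (chart_at (gamma t)) \o gamma) t 1).

(** By continuity the curve stays in the chart near [t], where [f \o gamma] factors through the
    coordinates and the chain rule applies. *)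
Lemma is_derive_along U f : open U -> U p -> smooth_fun U f ->
  is_derive t 1 (f \o gamma) (dirder T f).
Proof.
move=> oU Up hf; have cp : dom c p by exact: chart_atP.
have dfp : differentiable (f \o param c) ((coord c \o gamma) t).
  by apply: smooth_on_differentiable (hf c) _; exists p.
have dcg : differentiable (coord c \o gamma) t by exact/derivable1_diffP.
have nfg : \forall s \near t,
    ((f \o param c) \o (coord c \o gamma)) s = (f \o gamma) s.
  have := cg (dom_near cp).
  by apply: (@filterS _ (nbhs t)) => s cs; rewrite /= paramK.
apply: (near_eq_is_derive nfg); apply: DeriveDef.
  by apply/derivable1_diffP; exact: differentiable_comp.
rewrite deriveE; last exact: differentiable_comp.
rewrite diff_comp // /dirder /T /velocity tangent_ofE //.
by rewrite [RHS]deriveE // derive1E deriveE.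
Qed.

(** The bridge from the connection to the curve: [is_derive_along] turns the directional derivatives
    in [nabla_coord] into derivatives in the parameter, which yields the formula defining
    [cov_der]. *)
Lemma is_cov_der_field U X : open U -> U p -> smooth_field U X ->
  is_cov_der (fun s => X (gamma s)) (nabla D T X).
Proof.
move=> oU Up hX; have cp : dom c p by exact: chart_atP.
have hXj j : is_derive t 1 (fun s => X (gamma s) c 0 j)
    (dirder T (fun q => X q c 0 j)).
  apply: (@is_derive_along (U `&` dom c) (fun q => X q c 0 j)).
  - by apply: openI => //; exact: open_dom.
  - by [].
  - apply: smooth_component; first by apply: openI => //; exact: open_dom.
      by move=> q [].
    by apply: smooth_fieldS hX => q [].
have dX : derivable (fun s => X (gamma s) c) t 1.
  apply/derivable_mxP => i j; rewrite (ord1 i).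
  exact: (@ex_derive _ _ _ _ _ _ _ (hXj j)).
split=> //; rewrite (nabla_coord D T oU Up cp hX) big_split /=.
rewrite /cov_der; congr (_ + _).
apply: (tangent_eqP cp); rewrite tangent_ofE // components_sum derive1E.
rewrite (derive_mx dX).
rewrite [LHS]row_sum_delta; apply: eq_bigr => j _.
rewrite componentsZ /coord_field tangent_ofE // mxE; congr (_ *: _).
exact: (@derive_val _ _ _ _ _ _ _ (hXj j)).
Qed.

End AlongCurve.

(** * Trans-Sasakian geometry *)

Lemma linear_sumZ (R : realType) (U V : lmodType R) (f : U -> V) m
    (a : 'I_m -> R) (e : 'I_m -> U) : linear f ->
  f (\sum_i a i *: e i) = \sum_i a i *: f (e i).
Proof.
move=> lf; pose fM := GRing.isLinear.Build _ _ _ _ _ lf.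
pose fL : {linear _ -> _} := HB.pack f fM.
rewrite -[f]/(fL : U -> V) linear_sum.
by apply: eq_bigr => i _; rewrite linearZ.
Qed.

(** * Bilinearity of the metric and its differentiability along curves *)

Section Metric.
Context {R : realType} {n : nat} {M : smoothManifold R n}.
Context (g : riemannian_metric M).

Lemma metricDr p (u v w : tangent p) :
  metric g u (v + w) = metric g u v + metric g u w.
Proof. by have := metric_linear g u 1 v w; rewrite !scale1r. Qed.

Lemma metric0r p (u : tangent p) : metric g u 0 = 0.
Proof.
have := metricDr u 0 0; rewrite addr0 => h.
by apply: (@addrI _ (metric g u 0)); rewrite -h addr0.
Qed.

Lemma metricZr p a (u v : tangent p) : metric g u (a *: v) = a * metric g u v.
Proof. by have := metric_linear g u a v 0; rewrite metric0r !addr0. Qed.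

Lemma metricDl p (u v w : tangent p) :
  metric g (v + w) u = metric g v u + metric g w u.
Proof. by rewrite !(Defs.metric_sym g _ u) metricDr. Qed.

Lemma metricZl p a (u v : tangent p) : metric g (a *: v) u = a * metric g v u.
Proof. by rewrite !(Defs.metric_sym g _ u) metricZr. Qed.

Lemma metric_eq0 p (u : tangent p) : metric g u u = 0 -> u = 0.
Proof.
move=> h; apply/eqP; apply: contraPT h => /(metric_pos g) h.
by apply/eqP; rewrite gt_eqF.
Qed.

(** Near [t] the product is the sum of V^i W^j g_ij, with g_ij smooth on the chart. It serves to
    make [theta] differentiable. *)
Lemma derivable_metric (D : affine_connection M) gamma (t : R)
    (V W : field_along gamma) (v w : tangent (gamma t)) :
  gamma s @[s --> t] --> gamma t ->
  derivable (coord (chart_at (gamma t)) \o gamma) t 1 ->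
  is_cov_der D V v -> is_cov_der D W w ->
  derivable (fun s => metric g (V s) (W s)) t 1.
Proof.
move=> cg dg [dV _] [dW _]; set c := chart_at (gamma t) in dg dV dW.
have cp : dom c (gamma t) by exact: chart_atP.
pose G i j q := metric g (coord_field c i q) (coord_field c j q).
have hG i j : smooth_fun (dom c) (G i j).
  by apply: metric_smooth; [exact: open_dom|exact: smooth_coord_field..].
pose h i j s := V s c 0 i * W s c 0 j * G i j (gamma s).
have dh i j : derivable (h i j) t 1.
  have dVi := (derivable_mxP _ _ _).1 dV 0 i.
  have dWj := (derivable_mxP _ _ _).1 dW 0 j.
  have dGij := is_derive_along cg dg (@open_dom _ _ _ c) cp (hG i j).
  apply: derivableM; first exact: (derivableM dVi dWj).
  exact: (@ex_derive _ _ _ _ _ _ _ dGij).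
have dsum : derivable (\sum_i \sum_j h i j) t 1.
  by apply: derivable_sum => i; apply: derivable_sum => j; exact: dh.
apply: near_eq_derivable dsum.
have := cg (dom c) (dom_near cp).
apply: (@filterS _ (nbhs t)) => s cs.
rewrite [in RHS](tangent_sum_coord (W s) cs).
rewrite (linear_sumZ _ _ (@metric_linear _ _ _ g _ _)).
rewrite fct_sumE; under eq_bigr do rewrite fct_sumE.
rewrite exchange_big; apply: eq_bigr => j _ /=.
rewrite Defs.metric_sym [in RHS](tangent_sum_coord (V s) cs).
rewrite (linear_sumZ _ _ (@metric_linear _ _ _ g _ _)) scaler_sumr.
apply: eq_bigr => i _; rewrite /h /G Defs.metric_sym.
by rewrite [X in _ = X]mulrA (mulrC (V s c 0 i)).
Qed.

End Metric.

(** * Almost contact identities and the covariant derivatives of xi and phi *)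

Section AlmostContact.
Context {R : realType} {n : nat} {M : smoothManifold R n}.
Context (S : almost_contact_metric M).

Lemma phi_xi p : acm_phi S p (acm_xi S p) = 0.
Proof.
apply: (@metric_eq0 _ _ _ S).
by rewrite metric_phi metric_xi eta_xi mulr1 subrr.
Qed.

(** Computing phi^3 u as phi^2 (phi u) and as phi (phi^2 u) gives eta(phi u) xi = 0; then eta is
    applied. *)
Lemma eta_phi p (u : tangent p) : acm_eta S p (acm_phi S p u) = 0.
Proof.
have h : acm_eta S p (acm_phi S p u) *: acm_xi S p = 0.
  apply: (@addrI _ (- acm_phi S p u)); rewrite -phi_sq (phi_sq S u).
  by rewrite linearD linearN linearZ /= phi_xi scaler0.
have : acm_eta S p (acm_eta S p (acm_phi S p u) *: acm_xi S p) = 0.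
  by rewrite h linear0.
by rewrite linearZ /= eta_xi [X in X = _]mulr1.
Qed.

(** The product g(phi u, phi^2 u) equals g(u, phi u) by compatibility and - g(phi u, u) by the
    formula for phi^2. *)
Lemma metric_phir p (u : tangent p) : metric S (acm_phi S p u) u = 0.
Proof.
have := metric_phi S u (acm_phi S p u).
rewrite eta_phi mulr0 subr0 phi_sq metricDr metricZr metric_xi eta_phi mulr0.
rewrite addr0.
rewrite -[- u]scaleN1r metricZr (Defs.metric_sym S u) => h; lra.
Qed.

Lemma metric_phi_horizontal p (u : tangent p) : acm_eta S p u = 0 ->
  metric S (acm_phi S p u) (acm_phi S p u) = metric S u u.
Proof. by move=> h; rewrite metric_phi h mulr0 subr0. Qed.

Lemma metric_xi_xi p : metric S (acm_xi S p) (acm_xi S p) = 1.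
Proof. by rewrite metric_xi eta_xi. Qed.

Lemma metric_phi_xi p (u : tangent p) :
  metric S (acm_phi S p u) (acm_xi S p) = 0.
Proof. by rewrite metric_xi eta_phi. Qed.

Context (D : affine_connection M) (alpha beta : M -> R).

Definition sasaki_rhs p (u v : tangent p) : tangent p :=
  alpha p *: (metric S u v *: acm_xi S p - acm_eta S p v *: u) +
  beta p *: (metric S (acm_phi S p u) v *: acm_xi S p -
             acm_eta S p v *: acm_phi S p u).

Lemma sasaki_rhs_linear p (u : tangent p) : linear (sasaki_rhs u).
Proof.
have E a b m1 m2 e1 e2 (A B : tangent p) :
    b *: ((a * m1 + m2) *: A - (a * e1 + e2) *: B) =
    a *: (b *: (m1 *: A - e1 *: B)) + b *: (m2 *: A - e2 *: B).
  rewrite !scalerDl -!scalerA opprD addrACA -scalerBr scalerDr.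
  by rewrite !(scalerA a b) !(scalerA b a) (mulrC b a).
move=> a v w.
have He : acm_eta S p (a *: v + w) = a * acm_eta S p v + acm_eta S p w.
  exact: linearP.
rewrite /sasaki_rhs He !metricDr !metricZr !E.
by rewrite addrACA -scalerDr.
Qed.

Context (tS : trans_sasakian S D alpha beta).

(** The trans-Sasakian identity asks for a field in the direction slot; [u] is extended with
    constant coefficients in a coordinate frame. *)
Lemma nabla_phiE U Y p (u : tangent p) : open U -> smooth_field U Y -> U p ->
  nabla_phi S D u Y = sasaki_rhs u (Y p).
Proof.
move=> oU hY Up; have cp := chart_atP p; set c := chart_at p in cp.
have oUc : open (U `&` dom c) by apply: openI => //; exact: open_dom.
pose X : vector_field M := fun q => \sum_j u c 0 j *: coord_field c j q.
have hX : smooth_field (U `&` dom c) X.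
  apply: smooth_field_sum => // j; apply: smooth_fieldZ => //.
    exact: smooth_fun_cst.
  by apply: smooth_fieldS (smooth_coord_field c j) => q [].
have hY' : smooth_field (U `&` dom c) Y by apply: smooth_fieldS hY => q [].
have Xp : X p = u by rewrite /X -tangent_sum_coord.
have [_ _ _ /(_ _ X Y p oUc hX hY' (conj Up cp))] := tS.
by rewrite Xp.
Qed.

Lemma nabla_xi p (u : tangent p) : metric_compatible D S ->
  acm_eta S p u = 0 ->
  nabla D u (acm_xi S) = - alpha p *: acm_phi S p u + beta p *: u.
Proof.
move=> mc u0; set w := nabla D u (acm_xi S).
have hx : smooth_field setT (acm_xi S) by exact: xi_smooth.
(* Differentiating g(xi, xi) = 1 gives 2 g(w, xi) = 0. *)
have w0 : acm_eta S p w = 0.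
  have := mc setT (acm_xi S) (acm_xi S) p u openT hx hx I.
  have -> : (fun q => metric S (acm_xi S q) (acm_xi S q)) = fun=> 1.
    by apply/funext => q; exact: metric_xi_xi.
  rewrite dirder_cst (Defs.metric_sym S (acm_xi S p)) -/w metric_xi => h.
  by lra.
have := nabla_phiE u openT hx I.
rewrite /nabla_phi -/w.
have -> : (fun q => acm_phi S q (acm_xi S q)) = fun q => 0.
  by apply: functional_extensionality_dep => q; exact: phi_xi.
rewrite nabla0 sub0r /sasaki_rhs !metric_xi u0 eta_phi eta_xi !scale0r !sub0r.
(* The identity now reads phi w = alpha u + beta phi u; as [w] and [u] lie in ker eta, phi^2 acts on
   both as -1. *)
rewrite !scale1r !scalerN -opprD => /oppr_inj /(congr1 (acm_phi S p)).
rewrite phi_sq w0 scale0r addr0 linearD !linearZ /= phi_sq u0 scale0r addr0.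
move=> /(congr1 -%R); rewrite opprK => ->.
by rewrite opprD scalerN opprK scaleNr.
Qed.

Context (gamma : R -> M) (t : R).
Context (cg : gamma s @[s --> t] --> gamma t).
Context (dg : derivable (coord (chart_at (gamma t)) \o gamma) t 1).

(** With V = sum_j V^j d_j, the fields phi d_j are defined on the chart, so nabla_T (phi d_j) splits
    into phi (nabla_T d_j) and (nabla_T phi) d_j. Linearity of [sasaki_rhs] in its second argument
    reassembles the latter terms. *)
Lemma is_cov_der_phi (V : field_along gamma) (v : tangent (gamma t)) :
  is_cov_der D V v ->
  is_cov_der D (fun s => acm_phi S (gamma s) (V s))
    (acm_phi S (gamma t) v + sasaki_rhs (velocity gamma t) (V t)).
Proof.
move=> [dV vE]; set c := chart_at (gamma t) in dV vE.
set T := velocity gamma t.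
have cp : dom c (gamma t) by exact: chart_atP.
have hc j : smooth_field (dom c) (fun q => acm_phi S q (coord_field c j q)).
  by apply: phi_smooth; [exact: open_dom|exact: smooth_coord_field].
have hV j : is_derive t 1 (fun s => V s c 0 j) ('D_1 (fun s => V s c) t 0 j).
  rewrite -derive_coord //; apply: derivableP.
  exact: ((derivable_mxP _ _ _).1 dV 0 j).
have hj j := is_cov_derZ (hV j)
  (is_cov_der_field D cg dg (@open_dom _ _ _ c) cp (hc j)).
have := is_cov_der_sum hj; set w := \sum_j _.
have -> : w = acm_phi S (gamma t) v + sasaki_rhs T (V t).
  rewrite {1}(tangent_sum_coord (V t) cp).
  rewrite (linear_sumZ _ _ (sasaki_rhs_linear T)).
  rewrite -vE /cov_der linearD linear_sum -addrA -big_split /=.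
  rewrite (tangent_sum_coord (tangent_of _ _ _) cp) tangent_ofE // linear_sum.
  rewrite -big_split /=; apply: eq_bigr => j _.
  rewrite linearZ derive1E; congr (_ + _).
  rewrite linearZ -scalerDr; congr (_ *: _).
  have hcj := @smooth_coord_field _ _ _ c j.
  rewrite -(nabla_phiE T (@open_dom _ _ _ c) hcj cp).
  by rewrite /nabla_phi addrC subrK.
apply: near_is_cov_der.
have := cg (dom_near cp).
apply: (@filterS _ (nbhs t)) => s cs.
rewrite [in RHS](tangent_sum_coord (V s) cs) linear_sum.
by apply: eq_bigr => j _; rewrite linearZ.
Qed.

End AlmostContact.

(** * Curvature and torsion *)

Lemma is_derive_div (R : realType) (f h : R -> R) (t df dh : R) :
  is_derive t 1 f df -> is_derive t 1 h dh -> h t != 0 ->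
  is_derive t 1 (fun s => f s / h s) ((df * h t - f t * dh) / h t ^+ 2).
Proof.
move=> Df Dh h0.
have DV : is_derive t 1 (fun s => (h s)^-1) (- (h t) ^- 2 *: dh).
  apply: DeriveDef; first exact: (derivableV h0 (@ex_derive _ _ _ _ _ _ _ Dh)).
  by rewrite (deriveV h0 (@ex_derive _ _ _ _ _ _ _ Dh)) derive_val.
have H : is_derive t 1 (fun s => f s / h s) _ := is_deriveM Df DV.
apply: (is_derive_eq H).
by rewrite /GRing.scale /=; field.
Qed.

(* Differentiating [k^2 = b^2 + h^2] eliminates [dk]. *)
Lemma frenet_torsion_algebra (R : realType) (k b h dk db dh a : R) :
  k != 0 -> k ^+ 2 = b ^+ 2 + h ^+ 2 -> k * dk = b * db + h * dh ->
  let w := a + (b * dh - db * h) / k ^+ 2 in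
  - ((db * k - b * dk) / k ^+ 2) + h / k * a = h / k * w /\
  (dh * k - h * dk) / k ^+ 2 + b / k * a = b / k * w.
Proof.
move=> k0 kE dkE w.
(* The unit vector (b/k, h/k) rotates with angular speed (b dh - db h) / k^2; [eb] and [eh] are its
   two components. *)
have eb : db * k - b * dk = - (h * (b * dh - db * h) / k).
  apply: (mulIf k0); rewrite mulNr (divfK k0) mulrBl -mulrA -expr2 kE.
  by rewrite -(mulrA b) (mulrC dk) dkE; ring.
have eh : dh * k - h * dk = b * (b * dh - db * h) / k.
  apply: (mulIf k0); rewrite (divfK k0) mulrBl -mulrA -expr2 kE.
  by rewrite -(mulrA h) (mulrC dk) dkE; ring.
by rewrite /w eb eh; split; field.
Qed.

(** Collects the derivative of - c x + h f in the frame x = xi, f = phi T, u = T. The coefficient of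
    [u] is - (c b + h th) = - k, the Frenet term - kappa T. *)
Lemma frame_combination (R : realType) (V : lmodType R) (x f u : V)
    (c dc h dh a b th k A B : R) :
  k = c * b + h * th -> - dc + h * a = A -> dh + c * a = B ->
  - dc *: x + - c *: (- a *: f + b *: u) +
    (dh *: f + h *: (th *: - u + a *: x)) =
  - k *: u + (A *: x + B *: f).
Proof.
move=> -> <- <-.
rewrite !(scalerDr, scalerA, scaleNr, scalerN, scalerDl, opprD).
rewrite !(mulrN, mulNr, scaleNr, opprK).
by rewrite [LHS](AC ((1*2)*(1*2)) ((3*5)*((1*6)*(4*2)))).
Qed.

Section CurveSmoothness.
Context {R : realType} {n : nat} {M : smoothManifold R n}.
Implicit Types (J : set R) (gamma : R -> M).

Lemma smooth_curve_derivable J gamma t : smooth_curve J gamma -> J t ->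
  derivable (coord (chart_at (gamma t)) \o gamma) t 1.
Proof.
move=> [_ sg] Jt; apply/derivable1_diffP.
by apply: smooth_on_differentiable (sg _) _; split=> //; exact: chart_atP.
Qed.

Lemma smooth_along_derivable J gamma (V : field_along gamma) t :
  smooth_along J V -> J t -> derivable (fun s => V s (chart_at (gamma t))) t 1.
Proof.
move=> sV Jt; apply/derivable1_diffP.
by apply: smooth_on_differentiable (sV _) _; split=> //; exact: chart_atP.
Qed.

Lemma smooth_on_derivable J (f : R -> R) t : smooth_on J f -> J t ->
  derivable f t 1.
Proof.
by move=> sf Jt; apply/derivable1_diffP; exact: smooth_on_differentiable sf Jt.
Qed.

End CurveSmoothness.

Theorem proposition3p2 (R : realType) (M : smoothManifold R 3)
  (S : almost_contact_metric M) (D : affine_connection M)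
  (alpha beta : M -> R)
  (I : set R) (gamma : R -> M)
  (r : nat) (E : nat -> field_along gamma) (k : nat -> R -> R)
  (theta : R -> R) :
  levi_civita D S ->
  trans_sasakian S D alpha beta ->
  is_interval I -> open I -> I !=set0 ->
  frenet_curve S D I r E k ->
  almost_contact_curve S I gamma ->
  ~ geodesic D I gamma ->
  (forall s, I s ->
     cov_der D (velocity gamma) s =
       - beta (gamma s) *: acm_xi S (gamma s) +
       theta s *: acm_phi S (gamma s) (velocity gamma s)) ->
  forall s, I s ->
    curvature r k s = Num.sqrt (beta (gamma s) ^+ 2 + theta s ^+ 2) /\
    torsion r k s =
      `| alpha (gamma s) +
         (beta (gamma s) * derive1 theta s - derive1 (beta \o gamma) s * theta s)
           / curvature r k s ^+ 2 |.
Proof.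
move=> [_ compat] tS _ oI _ F legendre ngeo accel.
have near_I s : I s -> \forall x \near s, I x.
  by move=> Is; exact: open_nbhs_nbhs.
have accelE s : I s -> cov_der D (E 1) s = cov_der D (velocity gamma) s.
  move=> Is; apply: near_cov_der.
  by apply: filterS (near_I s Is) => x; exact: (frenet_tangent F).
have r0 := frenet_rank F.
(* For [r = 1] both terms of the Frenet equation vanish and the curve would be a geodesic. *)
have r1 : (1 < r)%N.
  rewrite ltnNge; apply/negP => r1; apply: ngeo => s Is.
  rewrite -accelE // (frenet_eq F) // ?r0 //.
  by rewrite [(1 < r)%N]ltnNge r1 /= add0r.
have in1 : (0 < 1 <= r)%N by [].
have in2 : (0 < 2 <= r)%N by [].
pose T := velocity gamma; pose phiT s := acm_phi S (gamma s) (T s).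
pose xi s := acm_xi S (gamma s); pose K := k 1%N; pose N := E 2%N.
have K0 s : I s -> 0 < K s.
  by move=> Is; apply: (frenet_k_pos F) => //; rewrite r1.
have KN0 s : I s -> K s != 0 by move=> Is; rewrite gt_eqF // K0.
have KN s : I s -> K s *: N s = - beta (gamma s) *: xi s + theta s *: phiT s.
  move=> Is; rewrite -accel // -accelE // (frenet_eq F) //.
  by rewrite r1 /= add0r.
have TT s : I s -> metric S (T s) (T s) = 1.
  by move=> Is; rewrite /T -(frenet_tangent F) // (frenet_orthonormal F).
have phiT_phiT s : I s -> metric S (phiT s) (phiT s) = 1.
  by move=> Is; rewrite metric_phi_horizontal ?TT //; exact: legendre.
have xi_phiT s : metric S (xi s) (phiT s) = 0.
  by rewrite Defs.metric_sym metric_phi_xi.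
have norm2 s a b : I s ->
    metric S (a *: xi s + b *: phiT s) (a *: xi s + b *: phiT s) =
    a ^+ 2 + b ^+ 2.
  move=> Is; rewrite metricDr !metricDl !metricZr !metricZl.
  rewrite metric_xi_xi phiT_phiT // xi_phiT (Defs.metric_sym S (phiT s)).
  by rewrite xi_phiT; ring.
(* Both sides are the squared length of the acceleration [K s *: N s]. *)
have K2 s : I s -> K s ^+ 2 = beta (gamma s) ^+ 2 + theta s ^+ 2.
  move=> Is; rewrite -(sqrrN (beta _)) -(norm2 s) // -KN // metricZr metricZl.
  by rewrite (frenet_orthonormal F) //= mulr1.
(* Expresses [theta] through quantities already known to be differentiable. *)
have thetaE s : I s -> theta s = K s * metric S (N s) (phiT s).
  move=> Is; rewrite -metricZl KN // metricDl !metricZl xi_phiT phiT_phiT //.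
  by rewrite mulr0 add0r mulr1.
have NE s : I s ->
    N s = - (beta (gamma s) / K s) *: xi s + (theta s / K s) *: phiT s.
  move=> Is; apply: (scalerI (KN0 _ Is)); rewrite KN // scalerDr !scalerA mulrN.
  by rewrite !(mulrC (K s)) !divfK // KN0.
move=> t It.
have curvE : curvature r k t = K t by rewrite /curvature r1.
rewrite curvE; split.
  by rewrite -K2 // sqrtr_sqr ger0_norm // ltW // K0.
have cg : gamma s @[s --> t] --> gamma t by apply: (frenet_curve_smooth F).1.
have dg := smooth_curve_derivable (frenet_curve_smooth F) It.
have cT : is_cov_der D T (- beta (gamma t) *: xi t + theta t *: phiT t).
  rewrite -(accel t It) -(accelE t It); apply: near_is_cov_der.
    by apply: filterS (near_I t It) => x; exact: (frenet_tangent F).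
  apply: is_cov_der_derivable.
  exact: (smooth_along_derivable (frenet_smooth F in1) It).
have cphiT := is_cov_der_phi tS cg dg cT.
have cN := is_cov_der_derivable D
  (smooth_along_derivable (frenet_smooth F in2) It).
have cxi := is_cov_der_field D cg dg openT Logic.I (xi_smooth S).
have [_ _ sbeta _] := tS.
have Dbeta : is_derive t 1 (beta \o gamma) (derive1 (beta \o gamma) t).
  rewrite derive1E; apply: derivableP.
  exact: (@ex_derive _ _ _ _ _ _ _ (is_derive_along cg dg openT Logic.I sbeta)).
have DK : is_derive t 1 K (derive1 K t).
  rewrite derive1E; apply: derivableP.
  by apply: smooth_on_derivable (frenet_k_smooth F _) It; rewrite r1.
have Dtheta : is_derive t 1 theta (derive1 theta t).
  rewrite derive1E; apply: derivableP.
  apply: (@near_eq_derivable _ _ _ (K * (fun s => metric S (N s) (phiT s)))).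
    by apply: filterS (near_I t It) => x Ix; rewrite [RHS]thetaE.
  apply: derivableM; first exact: (@ex_derive _ _ _ _ _ _ _ DK).
  exact: derivable_metric cg dg cN cphiT.
have KdK : K t * derive1 K t =
    beta (gamma t) * derive1 (beta \o gamma) t + theta t * derive1 theta t.
  have KK : \forall x \near t, K x * K x =
      (beta \o gamma) x * (beta \o gamma) x + theta x * theta x.
    by apply: filterS (near_I t It) => x Ix; rewrite -!expr2 K2.
  have DKK : is_derive t 1 (fun x => K x * K x) _ := is_deriveM DK DK.
  have Dbh : is_derive t 1 (fun x => (beta \o gamma) x * (beta \o gamma) x +
      theta x * theta x) _ :=
    is_deriveD (is_deriveM Dbeta Dbeta) (is_deriveM Dtheta Dtheta).
  have [_] := near_eq_is_derive KK DKK; have [_ ->] := Dbh.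
  by rewrite /GRing.scale /= => h; lra.
have Db := is_deriveN (is_derive_div Dbeta DK (KN0 _ It)).
have Dh := is_derive_div Dtheta DK (KN0 _ It).
have cN' := is_cov_derD (is_cov_derZ Db cxi) (is_cov_derZ Dh cphiT).
have xiE : nabla D (T t) (acm_xi S) =
    - alpha (gamma t) *: phiT t + beta (gamma t) *: T t.
  by rewrite (nabla_xi tS compat) //; exact: legendre.
have phi_accel :
    acm_phi S (gamma t) (- beta (gamma t) *: xi t + theta t *: phiT t) =
    theta t *: - T t.
  rewrite linearD !linearZ /= phi_xi scaler0 add0r phi_sq.
  by rewrite (legendre t It) scale0r addr0.
have rhsE : sasaki_rhs S alpha beta (T t) (T t) = alpha (gamma t) *: xi t.
  rewrite /sasaki_rhs TT // metric_phir (legendre t It) !scale0r subr0 subrr.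
  by rewrite scaler0 addr0 scale1r.
(* [Z] is tau B, taken to be 0 when there is no third frame vector, in agreement with the default
   value of [torsion]. *)
pose Z := if (2 < r)%N then k 2%N t *: E 3%N t else 0.
have frenet2 : cov_der D N t = - K t *: T t + Z.
  by rewrite (frenet_eq F) //= (frenet_tangent F).
set w := alpha (gamma t) + _.
have [eb eh] :=
  frenet_torsion_algebra (alpha (gamma t)) (KN0 _ It) (K2 _ It) KdK.
have ZE :
    Z = (theta t / K t * w) *: xi t + (beta (gamma t) / K t * w) *: phiT t.
  apply: (@addrI _ (- K t *: T t)); rewrite -frenet2.
  (* The formula for N holds on the open set [I] only, which suffices as [cov_der] depends on the
     germ at [t]. *)
  transitivity (cov_der D (fun s => - (beta (gamma s) / K s) *: xi s +
      (theta s / K s) *: phiT s) t).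
    by apply: near_cov_der; apply: filterS (near_I t It) => x; exact: NE.
  rewrite cN'.2 -/(T t) xiE phi_accel rhsE; apply: frame_combination => //.
  by apply: (mulIf (KN0 _ It)); rewrite -expr2 K2 //=; field; exact: KN0.
have torsion2 : torsion r k t ^+ 2 = metric S Z Z.
  rewrite /torsion /Z; case: ifP => r2; last by rewrite metric0r expr0n.
  by rewrite metricZr metricZl (frenet_orthonormal F) //= mulr1.
have torsion_ge0 : 0 <= torsion r k t.
  rewrite /torsion; case: ifP => // r2; apply: ltW.
  by apply: (frenet_k_pos F) => //; rewrite r2.
(* Both sides become square roots; the squared length of [Z] is w^2 (theta^2 + beta^2) / K^2 =
   w^2. *)
rewrite -(ger0_norm torsion_ge0) -sqrtr_sqr torsion2 ZE norm2 // -sqrtr_sqr.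
congr Num.sqrt; rewrite !exprMn -mulrDl !exprVn -mulrDl addrC -K2 //.
by rewrite divff ?mul1r // expf_neq0 // KN0.
Qed.
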